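(* Let $G$ be a finite simple graph with $m$ edges, and let $s^+$ and $s^-$ denote the sums of the squares of the positive and of the negative eigenvalues (counted with multiplicity) of the adjacency matrix of $G$, respectively. Then $$\min\{s^+,s^-\}\ \ge\ \frac{2m}{\chi_{\mathrm{vec}}(G)},$$ where $\chi_{\mathrm{vec}}(G)$ is the vector chromatic number of $G$.
   Context: Graphs are finite and simple, with at least one vertex. $\overline{A}$ is the adjacency matrix of the complement of $G$, $I$ the identity, $J$ the all-ones matrix, $\langle M,N\rangle=\mathrm{tr}(MN)$ on real symmetric matrices, and $\circ$ the entrywise product. $Z\ge 0$ means all entries of $Z$ are nonnegative; $Z\succeq 0$ means $Z$ is real symmetric positive semidefinite. The vector chromatic number $\chi_{\mathrm{vec}}(G)$ is the maximum of $\langle J,Z\rangle$ over real symmetric matrices $Z$ indexed by $V(G)$ with $\langle I,Z\rangle=1$, $Z\circ\overline{A}=0$, $Z\ge 0$, $Z\succeq 0$. *)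

(* Defs.v *)
From HB Require Import structures.
From mathcomp Require Import all_boot all_order all_algebra.
From mathcomp Require Import all_classical all_reals all_analysis.
From mathcomp Require Import lra.

Set Implicit Arguments.
Unset Strict Implicit.
Unset Printing Implicit Defensive.

Import Order.TTheory GRing.Theory Num.Theory.
Import numFieldNormedType.Exports.

Local Open Scope ring_scope.
Local Open Scope classical_set_scope.

(* Simple graphs: a symmetric irreflexive relation [e] on a finite type [V].
   Matrices indexed by [V] are indexed by ['I_#|V|] through [enum_val]. *)

Definition edge_set (V : finType) (e : rel V) : {set {set V}} :=
  [set [set p.1; p.2]%SET | p in [pred p : V * V | e p.1 p.2]]%SET.

Definition compl_rel (V : finType) (e : rel V) : rel V :=
  fun x y => (x != y) && ~~ e x y.

Definition adj (R : realType) (V : finType) (e : rel V) : 'M[R]_#|V| :=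
  \matrix_(i, j) (e (enum_val i) (enum_val j))%:R.

(* Eigenvalues are counted with their multiplicity as roots of the
   characteristic polynomial; the sums below have finite support. *)

Definition sum_sqr_pos_eigen (R : realType) n (A : 'M[R]_n) : R :=
  \sum_(x \in [set x : R | eigenvalue A x /\ 0 < x])
    (mup x (char_poly A))%:R * x ^+ 2.

Definition sum_sqr_neg_eigen (R : realType) n (A : 'M[R]_n) : R :=
  \sum_(x \in [set x : R | eigenvalue A x /\ x < 0])
    (mup x (char_poly A))%:R * x ^+ 2.

Definition mxdot (R : realType) n (M N : 'M[R]_n) : R := \tr (M *m N).

Definition hadamard (R : realType) n (M N : 'M[R]_n) : 'M[R]_n :=
  map2_mx *%R M N.

Definition psd (R : realType) n (Z : 'M[R]_n) : Prop :=
  Z^T = Z /\ forall v : 'cV[R]_n, 0 <= (v^T *m Z *m v) 0 0.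

Definition vec_feasible (R : realType) (V : finType) (e : rel V)
    (Z : 'M[R]_#|V|) : Prop :=
  [/\ mxdot 1%:M Z = 1,
      hadamard Z (adj R (compl_rel e)) = 0,
      forall i j, 0 <= Z i j
    & psd Z].

(* The supremum is a maximum: see [vec_chrom_max]. *)
Definition vec_chrom (R : realType) (V : finType) (e : rel V) : R :=
  sup [set mxdot (const_mx 1) Z | Z in @vec_feasible R V e].

Section VecChromMax.
Variables (R : realType) (V : finType) (e : rel V).

Lemma vec_feasible_ex : (0 < #|V|)%N -> exists Z, @vec_feasible R V e Z.
Proof.
move=> V0; have n0 : (#|V|%:R : R) != 0 by rewrite pnatr_eq0 -lt0n.
exists (#|V|%:R^-1)%:M; split.
- by rewrite /mxdot mul1mx mxtrace_scalar -[LHS]mulr_natr mulVf.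
- apply/matrixP => i j; rewrite !mxE /compl_rel.
  by case: (eqVneq i j) => [->|_]; rewrite ?eqxx ?mulr0n ?mulr0 ?mul0r.
- by move=> i j; rewrite mxE mulrn_wge0.
- split=> [|v]; first by rewrite tr_scalar_mx.
  rewrite -mulmxA mul_scalar_mx -scalemxAr mxE mulr_ge0// mxE sumr_ge0// => i _.
  by rewrite mxE -expr2 sqr_ge0.
Qed.

Lemma vec_feasible_bound (Z : 'M[R]_#|V|) i j :
  vec_feasible e Z -> 0 <= Z i j <= 1.
Proof.
case=> trZ _ Z0 [symZ psdZ]; rewrite Z0 /=.
have dle k : Z k k <= 1.
  by rewrite -trZ /mxdot mul1mx /mxtrace (bigD1 k)//= lerDl sumr_ge0.
have eZ (a b : 'I_#|V|) :
    ((delta_mx 0 a : 'rV[R]_#|V|) *m Z *m (delta_mx b 0 : 'cV_#|V|)) 0 0 = Z a b.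
  by rewrite -rowE -colE !mxE.
have := psdZ (delta_mx i 0 - delta_mx j 0).
rewrite [(_ - _)^T]linearB /= !trmx_delta !(mulmxBl, mulmxBr) !mxE.
move: (eZ i i) (eZ i j) (eZ j i) (eZ j j); rewrite !mxE => -> -> -> ->.
have -> : Z j i = Z i j by rewrite -[in LHS]symZ mxE.
move=> h; have := dle i; have := dle j.
by move: h; lra.
Qed.

Lemma rV_linear_continuous n (f : 'rV[R]_n -> R) :
  (forall u v, f (u + v) = f u + f v) -> (forall a v, f (a *: v) = a * f v) ->
  continuous f.
Proof.
move=> fD fZ.
have f0 : f 0 = 0 by rewrite -(scale0r 0) fZ mul0r.
have -> : f = fun v => \sum_(k <- enum 'I_n) v 0 k * f (delta_mx 0 k).
  apply/funext => v; rewrite {1}[v]row_sum_delta big_enum /=.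
  by rewrite (big_morph f fD f0); apply: eq_bigr => k _; rewrite fZ.
elim: (enum 'I_n) => [|k s IH].
  have -> : (fun v : 'rV[R]_n => \sum_(k <- [::]) v 0 k * f (delta_mx 0 k))
      = fun=> 0 by apply/funext => v; rewrite big_nil.
  exact: cst_continuous.
have -> : (fun v : 'rV[R]_n => \sum_(k <- k :: s) v 0 k * f (delta_mx 0 k))
    = (fun v => v 0 k * f (delta_mx 0 k) + \sum_(k <- s) v 0 k * f (delta_mx 0 k)).
  by apply/funext => v; rewrite big_cons.
move=> v; have Fv : Filter (nbhs v) by exact: nbhs_filter.
have cMv := @cvgMr_tmp _ _ _ Fv _ _ (f (delta_mx 0 k)) (@coord_continuous R 1 n 0 k v).
exact: (@cvgD _ _ _ _ Fv _ _ _ _ cMv (IH v)).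
Qed.

Lemma vec_feasible_closed :
  closed [set v : 'rV[R]_(#|V| * #|V|) | vec_feasible e (vec_mx v)].
Proof.
pose n := #|V|.
have cl (D : set R) (f : 'M[R]_n -> R) : closed D ->
    (forall A B, f (A + B) = f A + f B) -> (forall a A, f (a *: A) = a * f A) ->
    closed [set v : 'rV[R]_(n * n) | D (f (vec_mx v))].
  move=> cD fD fZ; apply: (preimage_closed _ cD) => v _.
  by apply: rV_linear_continuous => [u w|a w]; rewrite !(linearD, linearZ) /= ?fD ?fZ.
have dotl (M : 'M[R]_n) (D : set R) : closed D ->
    closed [set v : 'rV[R]_(n * n) | D (mxdot M (vec_mx v))].
  move=> cD; apply: cl => // [A B|a A].
    by rewrite /mxdot mulmxDr mxtraceD.
  by rewrite /mxdot -scalemxAr mxtraceZ.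
have -> : [set v : 'rV[R]_(n * n) | vec_feasible e (vec_mx v)] =
    [set v | mxdot 1%:M (vec_mx v) = 1] `&`
    \bigcap_(p in [set: 'I_n * 'I_n])
      ([set v | vec_mx v p.1 p.2 * adj R (compl_rel e) p.1 p.2 = 0] `&`
       [set v | 0 <= vec_mx v p.1 p.2] `&`
       [set v | vec_mx v p.2 p.1 - vec_mx v p.1 p.2 = 0]) `&`
    \bigcap_(w in [set: 'cV[R]_n]) [set v | 0 <= (w^T *m vec_mx v *m w) 0 0].
  apply/seteqP; split=> v /=.
    case=> h1 h2 h3 [h4 h5]; split; last by move=> w _; exact: h5.
    split=> // -[i j] _ /=; split; last by rewrite -[in X in X - _]h4 mxE subrr.
    by split => //; move/matrixP: h2 => /(_ i j); rewrite !mxE.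
  case=> -[h1 h2] h3; split=> //.
  - by apply/matrixP => i j; have [[/= + _] _] := h2 (i, j) I; rewrite !mxE.
  - by move=> i j; have [[/= _ +] _] := h2 (i, j) I.
  - split=> [|w]; last exact: (h3 w I).
    apply/matrixP => i j; have [_ /= /subr0_eq] := h2 (i, j) I.
    by rewrite [in RHS]/= => <-; rewrite mxE.
apply: closedI; first apply: closedI.
- exact: (dotl _ _ (@closed_eq _ 1)).
- apply: closed_bigI => -[i j] _ /=; apply: closedI; first apply: closedI.
  + apply: (cl _ (fun A => A i j * _) (@closed_eq _ 0)) => [A B|a A].
      by rewrite mxE mulrDl.
    by rewrite mxE mulrA.
  + by apply: (cl _ (fun A => A i j) (@closed_ge _ 0)) => [A B|a A]; rewrite mxE.
  + apply: (cl _ (fun A => A j i - A i j) (@closed_eq _ 0)) => [A B|a A].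
      by rewrite !mxE opprD addrACA.
    by rewrite !mxE mulrBr.
- apply: closed_bigI => w _.
  apply: (cl _ (fun A => (w^T *m A *m w) 0 0) (@closed_ge _ 0)) => [A B|a A].
    by rewrite mulmxDr mulmxDl mxE.
  by rewrite -scalemxAr -scalemxAl mxE.
Qed.

Lemma vec_chrom_max : (0 < #|V|)%N ->
  (exists2 Z, @vec_feasible R V e Z & mxdot (const_mx 1) Z = vec_chrom R e) /\
  forall Z, vec_feasible e Z -> mxdot (const_mx 1) Z <= vec_chrom R e.
Proof.
move=> V0; have [Z0 fZ0] := vec_feasible_ex V0.
pose A := [set v : 'rV[R]_(#|V| * #|V|) | vec_feasible e (vec_mx v)].
pose f := fun v : 'rV[R]_(#|V| * #|V|) => mxdot (const_mx 1) (vec_mx v).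
have cf : continuous f.
  apply: rV_linear_continuous => [u v|a v]; rewrite /f /mxdot.
    by rewrite [vec_mx _]linearD mulmxDr mxtraceD.
  by rewrite [vec_mx _]linearZ -scalemxAr mxtraceZ.
have bA : bounded_set A.
  exists 1; split=> // M M1 v Av.
  rewrite /Num.norm /= mx_normrE; apply/bigmax_leP; split=> [|[i k] _ /=].
    by rewrite (le_trans ler01)// ltW.
  rewrite ord1 -[v]vec_mxK; case/mxvec_indexP: k => i' j.
  rewrite mxvecE; have /andP[h0 h1] := vec_feasible_bound i' j Av.
  by rewrite ger0_norm// (le_trans h1)// ltW.
have [||c Ac fmax] := @EVT_max_rV R _ f A _
    (bounded_closed_compact bA vec_feasible_closed).
- by exists (mxvec Z0); rewrite /A /= mxvecK.
- exact: continuous_subspaceT.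
have ub Z : vec_feasible e Z -> mxdot (const_mx 1) Z <= f c.
  by move=> fZ; rewrite -[Z]mxvecK; apply: fmax; rewrite inE /A /= mxvecK.
have fA : vec_feasible e (vec_mx c) by move: Ac; rewrite inE.
have -> : vec_chrom R e = f c.
  apply/eqP; rewrite eq_le; apply/andP; split.
    by apply: ge_sup => [|_ [Z fZ <-]]; [exists (f c), (vec_mx c)|exact: ub].
  by apply: ub_le_sup; [exists (f c) => _ [Z fZ <-]; exact: ub|exists (vec_mx c)].
by split=> //; exists (vec_mx c).
Qed.

End VecChromMax.

(* Main.v *)
(* Let A = P - N be the decomposition of the adjacency matrix into its positive
   and negative parts, so that s^- = ||A - P||^2 and s^+ = ||A + N||^2 in
   Frobenius norm.  It suffices to bound ||A - s Q||^2 from below for Q positive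
   semidefinite and s = 1 or -1.  Start from the entrywise square of Q, positive
   semidefinite by Schur, and add the Laplacian of its entries at non-edges:
   this clears the non-edges and moves their weight to the diagonal, so the
   result is feasible up to scaling.  Its trace T is the part of ||A - s Q||^2
   carried by the diagonal and the non-edges, and feasibility reads
   \sum_(i ~ j) Q_ij^2 <= (chi - 1) T.  Cauchy-Schwarz on each edge, applied to
   1 = s Q_ij + (1 - s Q_ij), concludes. *)

Require Import Defs.
From mathcomp Require Import all_boot all_order all_algebra.
From mathcomp Require Import all_classical all_reals all_analysis.
From mathcomp Require Import complex ring lra.
Set Implicit Arguments.
Unset Strict Implicit.
Unset Printing Implicit Defensive.

Import Order.TTheory GRing.Theory Num.Theory.
Local Open Scope ring_scope.

(** * Positive semidefinite matrices *)

Lemma quad_formE (R : comNzRingType) n (Z : 'M[R]_n) (v : 'cV[R]_n) :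
  (v^T *m Z *m v) 0 0 = \sum_i \sum_j v i 0 * Z i j * v j 0.
Proof.
rewrite mxE exchange_big /=; apply: eq_bigr => j _.
by rewrite mxE mulr_suml; apply: eq_bigr => i _; rewrite mxE.
Qed.

Lemma psdD (R : realType) n (Y Z : 'M[R]_n) : psd Y -> psd Z -> psd (Y + Z).
Proof.
move=> [symY posY] [symZ posZ]; split=> [|v]; first by rewrite linearD /= symY symZ.
by rewrite mulmxDr mulmxDl mxE addr_ge0.
Qed.

Lemma psdZ (R : realType) n (a : R) (Z : 'M[R]_n) :
  0 <= a -> psd Z -> psd (a *: Z).
Proof.
move=> a_ge0 [symZ posZ]; split=> [|v]; first by rewrite linearZ /= symZ.
by rewrite -scalemxAr -scalemxAl mxE mulr_ge0.
Qed.

(** Evaluate the quadratic form at the difference of the basis vectors [i] and [j]. *)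
Lemma psd_offdiag_le (R : realType) n (Z : 'M[R]_n) i j :
  psd Z -> 2 * Z i j <= Z i i + Z j j.
Proof.
move=> [symZ posZ].
have eZ (a b : 'I_n) :
    ((delta_mx 0 a : 'rV[R]_n) *m Z *m (delta_mx b 0 : 'cV_n)) 0 0 = Z a b.
  by rewrite -rowE -colE !mxE.
have := posZ (delta_mx i 0 - delta_mx j 0).
rewrite [(_ - _)^T]linearB /= !trmx_delta !(mulmxBl, mulmxBr) !mxE.
move: (eZ i i) (eZ i j) (eZ j i) (eZ j j); rewrite !mxE => -> -> -> ->.
have -> : Z j i = Z i j by rewrite -[in LHS]symZ mxE.
by lra.
Qed.

(* The quadratic form is the sum over k, l of (\sum_i v_i B_ki B_li)^2. *)
Lemma psd_hadamard_gram (R : realType) m n (B : 'M[R]_(m, n)) :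
  psd (hadamard (B^T *m B) (B^T *m B)).
Proof.
split=> [|v].
  have symP : (B^T *m B)^T = B^T *m B by rewrite trmx_mul trmxK.
  by apply/matrixP => i j; move/matrixP: symP => /(_ i j); rewrite !mxE => ->.
rewrite quad_formE.
suff -> : \sum_i \sum_j v i 0 * hadamard (B^T *m B) (B^T *m B) i j * v j 0
    = \sum_k \sum_l (\sum_i v i 0 * B k i * B l i) ^+ 2.
  by apply: sumr_ge0 => k _; apply: sumr_ge0 => l _; exact: sqr_ge0.
transitivity (\sum_i \sum_j \sum_k \sum_l
    (v i 0 * B k i * B l i) * (v j 0 * B k j * B l j)).
  apply: eq_bigr => i _; apply: eq_bigr => j _; rewrite !mxE.
  rewrite mulr_suml mulr_sumr mulr_suml; apply: eq_bigr => k _.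
  rewrite !mulr_sumr mulr_suml; apply: eq_bigr => l _; rewrite !mxE; ring.
rewrite (eq_bigr _ (fun i _ => exchange_big _ _ _ _ _ _)) exchange_big /=.
apply: eq_bigr => k _.
under eq_bigr do rewrite exchange_big /=.
rewrite exchange_big /=; apply: eq_bigr => l _.
by rewrite expr2 mulr_suml; apply: eq_bigr => i _; rewrite mulr_sumr.
Qed.

(* The quadratic form is half the sum over i, j of C_ij (v_i - v_j)^2. *)
Lemma psd_laplacian (R : realType) n (C : 'M[R]_n) :
  C^T = C -> (forall i j, 0 <= C i j) -> psd (diag_mx (\row_i \sum_j C i j) - C).
Proof.
move=> symC C_ge0; split=> [|v].
  by rewrite linearB /= tr_diag_mx symC.
have {}symC i j : C j i = C i j by rewrite -[in LHS]symC mxE.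
rewrite quad_formE.
set q := (X in 0 <= X).
suff q2 : \sum_i \sum_j C i j * (v i 0 - v j 0) ^+ 2 = 2 * q.
  rewrite -(pmulr_rge0 _ (@ltr0Sn R 1)) -q2.
  by apply: sumr_ge0 => i _; apply: sumr_ge0 => j _; rewrite mulr_ge0 ?sqr_ge0.
have qE : q = \sum_i \sum_j C i j * v i 0 ^+ 2 - \sum_i \sum_j v i 0 * C i j * v j 0.
  rewrite -sumrB; apply: eq_bigr => i _.
  under eq_bigr do rewrite !mxE mulrBr mulrBl.
  rewrite sumrB; congr (_ - _).
  rewrite -mulr_suml [LHS](bigD1 i) //= [X in _ + X]big1 => [|j ji].
    by rewrite eqxx mulr1n addr0 mulrAC mulrC -expr2.
  by rewrite eq_sym (negPf ji) mulr0n mulr0 mul0r.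
  have qE' : \sum_i \sum_j C i j * v j 0 ^+ 2 = \sum_i \sum_j C i j * v i 0 ^+ 2.
  by rewrite exchange_big; apply: eq_bigr => i _; apply: eq_bigr => j _; rewrite symC.
transitivity (\sum_i \sum_j C i j * v i 0 ^+ 2 + \sum_i \sum_j C i j * v j 0 ^+ 2
   - 2 * \sum_i \sum_j v i 0 * C i j * v j 0); last by rewrite qE' qE; ring.
rewrite mulr_sumr -big_split /= -sumrB; apply: eq_bigr => i _.
rewrite mulr_sumr -big_split /= -sumrB; apply: eq_bigr => j _; ring.
Qed.

(** * Bounds from the vector chromatic number *)

Lemma mxdot_ones (R : realType) n (Z : 'M[R]_n) :
  mxdot (const_mx 1) Z = \sum_i \sum_j Z i j.
Proof.
rewrite /mxdot /mxtrace exchange_big; apply: eq_bigr => i _.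
by rewrite mxE; apply: eq_bigr => j _; rewrite mxE mul1r.
Qed.

(* Feasibility without the normalization [mxdot 1%:M Z = 1]. *)
Lemma sum_le_vec_chrom (R : realType) (V : finType) (e : rel V)
    (Z : 'M[R]_#|V|) :
  (0 < #|V|)%N -> hadamard Z (adj R (compl_rel e)) = 0 ->
  (forall i j, 0 <= Z i j) -> psd Z ->
  \sum_i \sum_j Z i j <= vec_chrom R e * \tr Z.
Proof.
move=> V_gt0 Z_supp Z_ge0 Z_psd.
have [_ chi_max] := vec_chrom_max R e V_gt0.
have tr_ge0 : 0 <= \tr Z by apply: sumr_ge0.
(* With trace zero no rescaling is possible, but then the nonnegative diagonal vanishes and
   [psd_offdiag_le] makes every entry nonpositive. *)
have [trZ0|trZ_neq0] := eqVneq (\tr Z) 0.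
  have diag0 i : Z i i = 0.
    by move/psumr_eq0P: trZ0 => ->.
  rewrite trZ0 mulr0; apply: sumr_le0 => i _; apply: sumr_le0 => j _.
  by have := psd_offdiag_le i j Z_psd; rewrite !diag0; lra.
have trZ_gt0 : 0 < \tr Z by rewrite lt_def trZ_neq0.
rewrite -ler_pdivrMr // mulrC -mxdot_ones.
have := chi_max ((\tr Z)^-1 *: Z).
rewrite /mxdot -scalemxAr mxtraceZ; apply; split.
- by rewrite /mxdot mul1mx mxtraceZ mulVf.
- apply/matrixP => i j; move/matrixP: Z_supp => /(_ i j).
  by rewrite !mxE -mulrA => ->; rewrite mulr0.
- by move=> i j; rewrite mxE mulr_ge0 ?invr_ge0.
- by apply: psdZ; rewrite ?invr_ge0.
Qed.

(** The identity matrix is feasible up to scaling, and its entry sum equals its trace. *)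
Lemma vec_chrom_ge1 (R : realType) (V : finType) (e : rel V) :
  (0 < #|V|)%N -> 1 <= vec_chrom R e.
Proof.
move=> V_gt0; have n_gt0 : 0 < #|V|%:R :> R by rewrite ltr0n.
have scalar_psd : psd (1%:M : 'M[R]_#|V|).
  split=> [|v]; first by rewrite tr_scalar_mx.
  rewrite mulmx1 mxE sumr_ge0 // => i _.
  by rewrite mxE -expr2 sqr_ge0.
have -> : 1 <= vec_chrom R e = (#|V|%:R <= vec_chrom R e * #|V|%:R).
  by rewrite -[X in _ = (X <= _)]mul1r ler_pM2r.
have row1 (i : 'I_#|V|) : \sum_j (1%:M : 'M[R]_#|V|) i j = 1.
  rewrite (bigD1 i) //= big1 ?addr0 ?mxE ?eqxx // => j ji.
  by rewrite mxE eq_sym (negPf ji).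
rewrite -[in X in _ <= X](@mxtrace1 R).
have <- : \sum_i \sum_j (1%:M : 'M[R]_#|V|) i j = #|V|%:R.
  by rewrite (eq_bigr _ (fun i _ => row1 i)) sumr_const card_ord.
apply: sum_le_vec_chrom => //.
- apply/matrixP => i j; rewrite !mxE /compl_rel.
  by case: (eqVneq i j) => [->|_]; rewrite ?eqxx ?mulr0 ?mul0r.
- by move=> i j; rewrite mxE ler0n.
Qed.

(** * The lower bound on the Frobenius distance to a semidefinite matrix *)

(** The sign [s] treats both halves of the spectrum at once, and the semidefinite matrix is given as
    a Gram matrix so that its entrywise square is visibly semidefinite. *)
Lemma sum_adj_le (R : realType) (V : finType) (e : rel V) m
    (B : 'M[R]_(m, #|V|)) (s : R) :
  (0 < #|V|)%N -> symmetric e -> irreflexive e -> s ^+ 2 = 1 ->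
  \sum_i \sum_j adj R e i j <=
  vec_chrom R e * \sum_i \sum_j (adj R e - s *: (B^T *m B)) i j ^+ 2.
Proof.
move=> V_gt0 e_sym e_irr s2.
have chi_ge1 := @vec_chrom_ge1 R V e V_gt0.
have chi_bound := @sum_le_vec_chrom R V e _ V_gt0.
have PP_psd := psd_hadamard_gram B.
have symP : (B^T *m B)^T = B^T *m B by rewrite trmx_mul trmxK.
(* From here on [P] is known only to be symmetric with a semidefinite entrywise square. *)
move: (B^T *m B) (vec_chrom R e) symP PP_psd chi_ge1 chi_bound.
move=> P chi symP PP_psd chi_ge1 chi_bound.
have {}symP i j : P j i = P i j by rewrite -[in LHS]symP mxE.
have A_ge0 i j : 0 <= adj R e i j by rewrite mxE ler0n.
have N_ge0 i j : 0 <= adj R (compl_rel e) i j by rewrite mxE ler0n.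
have A_diag i : adj R e i i = 0 by rewrite mxE e_irr.
have A_sqr i j : adj R e i j ^+ 2 = adj R e i j.
  by rewrite mxE; case: (e _ _); rewrite ?expr0n ?expr1n.
have symN i j : adj R (compl_rel e) j i = adj R (compl_rel e) i j.
  by rewrite !mxE /compl_rel e_sym eq_sym.
have N_diag i : adj R (compl_rel e) i i = 0 by rewrite mxE /compl_rel eqxx.
have AN0 i j : adj R e i j * adj R (compl_rel e) i j = 0.
  by rewrite !mxE /compl_rel; case: (e _ _); rewrite ?andbF ?mulr0 ?mul0r.
have part i j : adj R (compl_rel e) i j = 1 - adj R e i j - (i == j)%:R.
  rewrite !mxE /compl_rel (inj_eq enum_val_inj).
  have [->|_] := eqVneq i j; first by rewrite e_irr subr0 subrr.
  by case: (e _ _) => /=; ring.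
move: (adj R e) (adj R (compl_rel e))
  chi_bound A_ge0 N_ge0 A_diag A_sqr symN N_diag AN0 part.
move=> A N chi_bound A_ge0 N_ge0 A_diag A_sqr symN N_diag AN0 part.
pose C : 'M[R]_#|V| := \matrix_(i, j) (N i j * P i j ^+ 2).
have CE i j : C i j = N i j * P i j ^+ 2 by rewrite mxE.
pose Z := hadamard P P + (diag_mx (\row_i \sum_j C i j) - C).
(* Off the diagonal only the edge entries of the entrywise square survive. *)
have ZE i j : Z i j = A i j * P i j ^+ 2
    + (i == j)%:R * (P i i ^+ 2 + \sum_k C i k).
  have -> : Z i j = P i j * P i j + ((\sum_k C i k) *+ (i == j) - C i j).
    by rewrite !mxE.
  rewrite CE part -mulr_natl.
  by have [->|_] := eqVneq i j => /=; ring.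
pose T := \sum_i (P i i ^+ 2 + \sum_k C i k).
pose S := \sum_i \sum_j A i j * P i j ^+ 2.
have C_ge0 i j : 0 <= C i j by rewrite CE mulr_ge0 ?sqr_ge0.
have sum_diag (f : 'I_#|V| -> R) i : \sum_j (i == j)%:R * f i = f i.
  rewrite (bigD1 i) //= big1 ?addr0 ?eqxx ?mul1r // => j ji.
  by rewrite eq_sym (negPf ji) mul0r.
have sumZ : \sum_i \sum_j Z i j = S + T.
  rewrite -big_split; apply: eq_bigr => i _ /=.
  under eq_bigr do rewrite ZE.
  by rewrite big_split /= (sum_diag (fun i => P i i ^+ 2 + \sum_k C i k)).
have trZ : \tr Z = T.
  have -> : \tr Z = \sum_i Z i i by [].
  by apply: eq_bigr => i _; rewrite ZE A_diag eqxx mul0r mul1r add0r.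
have ST : S + T <= chi * T.
  rewrite -sumZ -trZ; apply: chi_bound.
  - apply/matrixP => i j.
    have -> : hadamard Z N i j = Z i j * N i j by rewrite mxE.
    rewrite ZE [RHS]mxE mulrDl mulrAC AN0 mul0r add0r.
    by have [->|_] := eqVneq i j; rewrite ?N_diag ?mulr0 ?mul0r.
  - move=> i j; rewrite ZE addr_ge0 // mulr_ge0 ?ler0n ?sqr_ge0 //.
    by rewrite addr_ge0 ?sqr_ge0 ?sumr_ge0.
  - apply: psdD => //.
    apply: psd_laplacian => //; apply/matrixP => i j.
    by rewrite mxE !CE symN symP.
(* On the diagonal and at non-edges [A] vanishes, so by [s ^+ 2 = 1] the entry contributes
   [P i j ^+ 2]; these terms add up to [T]. *)
have frobE : \sum_i \sum_j (A - s *: P) i j ^+ 2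
    = T + \sum_i \sum_j A i j * (1 - s * P i j) ^+ 2.
  rewrite -big_split; apply: eq_bigr => i _ /=.
  rewrite -(sum_diag (fun i => P i i ^+ 2)) -!big_split /=.
  apply: eq_bigr => j _; rewrite CE part.
  have -> : (A - s *: P) i j = A i j - s * P i j by rewrite !mxE.
  have [<-|_] := eqVneq i j.
    by rewrite A_diag sub0r sqrrN exprMn s2 /=; ring.
  have -> : (A i j - s * P i j) ^+ 2 = A i j ^+ 2 - 2 * s * A i j * P i j
    + s ^+ 2 * P i j ^+ 2 by ring.
  rewrite A_sqr s2.
  have -> : (1 - s * P i j) ^+ 2 = 1 - 2 * s * P i j + s ^+ 2 * P i j ^+ 2 by ring.
  by rewrite s2 /=; ring.
have S_ge0 : 0 <= S.
  by apply: sumr_ge0 => i _; apply: sumr_ge0 => j _; rewrite mulr_ge0 ?sqr_ge0.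
(* The general argument cancels a factor [chi - 1]. If it is zero, [ST] forces [S = 0], so [P]
   vanishes on edges and each edge term of the norm equals that of [A]. *)
have [chi1|chi_neq1] := eqVneq chi 1.
  have S0 : S = 0 by move: ST; rewrite chi1; lra.
  have T_ge0 : 0 <= T.
    by apply: sumr_ge0 => i _; rewrite addr_ge0 ?sqr_ge0 ?sumr_ge0.
  rewrite chi1 mul1r frobE -[X in X <= _]add0r lerD //.
  apply: ler_sum => i _; apply: ler_sum => j _.
  have AP0 : A i j * P i j ^+ 2 = 0.
    have term_ge0 k l : 0 <= A k l * P k l ^+ 2 by rewrite mulr_ge0 ?sqr_ge0.
    move/psumr_eq0P: S0 => /(_ (fun k _ => sumr_ge0 _ (fun l _ => term_ge0 k l))).
    by move=> /(_ i isT) /psumr_eq0P ->.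
  move/eqP: AP0; rewrite mulf_eq0 sqrf_eq0 => /orP[] /eqP ->; first by rewrite mul0r.
  by rewrite mulr0 subr0 expr1n mulr1.
have chi_gt1 : 0 < chi - 1 by rewrite subr_gt0 lt_def chi_neq1.
(* Cauchy-Schwarz for 1 = s p + (1 - s p), with weights [chi - 1] and 1. *)
have edge_le i j : A i j * (chi - 1) <=
    chi * (A i j * P i j ^+ 2 + (chi - 1) * (A i j * (1 - s * P i j) ^+ 2)).
  rewrite -subr_ge0.
  have -> : chi * (A i j * P i j ^+ 2 + (chi - 1) * (A i j * (1 - s * P i j) ^+ 2))
      - A i j * (chi - 1) = A i j * ((chi - 1) - chi * (s * P i j)) ^+ 2
        + (1 - s ^+ 2) * (A i j * chi * P i j ^+ 2) by ring.
  by rewrite s2 subrr mul0r addr0 mulr_ge0 ?sqr_ge0.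
rewrite -(ler_pM2r chi_gt1) frobE.
set Q := \sum_i \sum_j A i j * (1 - s * P i j) ^+ 2.
(* Summing [edge_le] gives the first inequality; the second is [S <= (chi - 1) * T], from [ST]. *)
apply: (@le_trans _ _ (chi * (S + (chi - 1) * Q))).
  rewrite mulr_suml /S /Q mulr_sumr -big_split mulr_sumr /=; apply: ler_sum => i _.
  rewrite mulr_suml mulr_sumr -big_split mulr_sumr /=; apply: ler_sum => j _.
  exact: edge_le.
rewrite -mulrA ler_wpM2l //; first by lra.
by rewrite [leRHS]mulrC mulrDr lerD2r; lra.
Qed.

(** * Counting edges *)

(** Group the adjacent ordered pairs by their underlying set: the fibre over an edge consists of the
    two orderings of its ends, distinct by irreflexivity. *)
Lemma sum_adj (R : realType) (V : finType) (e : rel V) :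
  symmetric e -> irreflexive e ->
  \sum_i \sum_j adj R e i j = 2 * #|edge_set e|%:R.
Proof.
move=> e_sym e_irr.
pose E := [pred p : V * V | e p.1 p.2].
have -> : \sum_i \sum_j adj R e i j = #|E|%:R.
  pose f (x y : V) : R := (e x y)%:R.
  transitivity (\sum_(x : V) \sum_(y : V) f x y).
    rewrite [RHS](reindex _ (onW_bij _ (enum_val_bij V))) /=; apply: eq_bigr => i _.
    rewrite [RHS](reindex _ (onW_bij _ (enum_val_bij V))).
    by apply: eq_bigr => j _; rewrite mxE.
  rewrite pair_big /= -sum1_card natr_sum [RHS]big_mkcond /=.
  by apply: eq_bigr => p _; rewrite inE /f; case: (e _ _).
rewrite -natrM mulnC; congr _%:R.
rewrite -(sum1_card E) (partition_big_imset (fun p : V * V => [set p.1; p.2]%SET)) /=.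
rewrite -sum_nat_const; apply: eq_bigr => _ /imsetP[[x y] /= exy ->].
rewrite inE /= in exy.
have xy : x != y by apply: contraTneq exy => ->; rewrite e_irr.
have -> : 2%N = #|[set (x, y); (y, x)]%SET|.
  by rewrite cards2 xpair_eqE (negPf xy).
rewrite sum1_card; apply: eq_card => -[a b]; rewrite !inE /= !xpair_eqE.
apply/andP/orP => [[/= eab /eqP /setP eq_ab]|].
  rewrite inE /= in eab; have ab : a != b by apply: contraTneq eab => ->; rewrite e_irr.
  have := eq_ab a; have := eq_ab b; rewrite !inE !eqxx orbT /=.
  move=> /esym /orP[] /eqP b_eq /esym /orP[] /eqP a_eq; rewrite a_eq b_eq ?eqxx;
    by [left | right | rewrite a_eq b_eq eqxx in ab].
by case=> /andP[/eqP -> /eqP ->]; rewrite inE /= ?[e y x]e_sym exy; split=> //;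
  rewrite finset.setUC.
Qed.

(** * Spectral decomposition and sums over eigenvalues *)

(** When the characteristic polynomial splits, [mup] counts the occurrences of a root in [s], so
    weighted sums over distinct eigenvalues become plain sums over [s]. *)
Lemma sum_eigenE (R : realType) n (A : 'M[R]_n) (s : seq R) (D : pred R)
    (f : R -> R) :
  char_poly A = \prod_(y <- s) ('X - y%:P) ->
  \sum_(x \in [set x : R | eigenvalue A x /\ D x]%classic)
    (mup x (char_poly A))%:R * f x = \sum_(y <- s | D y) f y.
Proof.
move=> charA.
rewrite (fsbig_fwiden [seq y <- undup s | D y]); first last.
- move=> x [/=]; rewrite mem_filter mem_undup => /andP[Dx xs] notx; exfalso.
  by apply: notx; rewrite eigenvalue_root_char charA root_prod_XsubC.
- by rewrite filter_uniq ?undup_uniq.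
- move=> x [/=]; rewrite eigenvalue_root_char charA root_prod_XsubC => xs Dx.
  by rewrite mem_filter mem_undup Dx.
rewrite big_filter -[RHS]big_undup_iterop_count; apply: eq_bigr => x _.
by rewrite charA mu_prod_XsubC mulr_natl.
Qed.

Lemma char_poly_conjmx (F : fieldType) n (P A : 'M[F]_n) :
  P \in unitmx -> char_poly (invmx P *m A *m P) = char_poly A.
Proof.
move=> P_unit; pose Q := map_mx polyC P; pose Q' := map_mx polyC (invmx P).
have QQ : Q' *m Q = 1%:M by rewrite -map_mxM mulVmx // map_mx1.
rewrite /char_poly.
have -> : char_poly_mx (invmx P *m A *m P) = Q' *m char_poly_mx A *m Q.
  rewrite /char_poly_mx mulmxBr mulmxBl !map_mxM mul_mx_scalar -scalemxAl QQ.
  by rewrite scalemx1.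
by rewrite !det_mulmx mulrAC -det_mulmx QQ det1 mul1r.
Qed.

(* X and Y are the real and imaginary parts of a complex unitary matrix
   diagonalizing A; the last clause is only an inequality because M d is the
   real part of a complex matrix of squared norm \sum_k (d_k)^2. *)
Lemma symmetric_spectral (R : realType) n (A : 'M[R]_n) : A^T = A ->
  exists (r : 'rV[R]_n) (X Y : 'M[R]_n),
    let M d := X^T *m diag_mx d *m X + Y^T *m diag_mx d *m Y in
    [/\ char_poly A = \prod_k ('X - (r 0 k)%:P), A = M r
      & forall d, \sum_i \sum_j M d i j ^+ 2 <= \sum_k d 0 k ^+ 2].
Proof.
move=> symA; pose toC := real_complex R.
pose AC : 'M[R[i]%C]_n := map_mx toC A.
have toC_sum (F : 'I_n -> R) : toC (\sum_i F i) = \sum_i toC (F i).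
  by apply: (big_morph toC) => // x y; exact: (rmorphD toC).
have AC_herm : AC \is hermsymmx.
  apply: realsym_hermsym; last first.
    by apply/mxOverP => i j; rewrite mxE complex_real.
  apply/is_hermitianmxP; rewrite expr0 scale1r; apply/matrixP => i j.
  by rewrite !mxE -[in LHS]symA mxE.
pose P := spectralmx AC; pose sp := spectral_diag AC.
have P_unitary : P \is unitarymx by exact: spectral_unitarymx.
have P_unit : P \in unitmx by exact: unitarymx_unit.
have ACE : AC = invmx P *m diag_mx sp *m P.
  by apply/orthomx_spectralP/hermitian_normalmx.
pose r : 'rV[R]_n := map_mx (@complex.Re R) sp.
have spE : sp = map_mx toC r.
  apply/rowP => k; rewrite !mxE; apply/esym/RRe_real.
  by have /mxOverP := hermitian_spectral_diag_real AC_herm; apply.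
pose X := map_mx (@complex.Re R) P; pose Y := map_mx (@complex.Im R) P.
pose Z d := invmx P *m diag_mx (map_mx toC d) *m P.
(* Since [P] is unitary, entry [(i, j)] of [Z d] sums the conjugate of [P k i] times [d 0 k] times
   [P k j]. *)
have ReZ d : X^T *m diag_mx d *m X + Y^T *m diag_mx d *m Y = map_mx (@complex.Re R) (Z d).
  apply/matrixP => i j; rewrite /Z invmx_unitary // !mul_mx_diag !mxE -big_split.
  have ReD : {morph (@complex.Re R) : x y / x + y} by move=> [a b] [c d'].
  rewrite (big_morph _ ReD (erefl _)).
  apply: eq_bigr => k _; rewrite !mxE.
  case: (P k i) (P k j) => [a b] [c d'] /=; ring.
exists r, X, Y; split.
- apply: (map_poly_inj toC); rewrite map_char_poly -/AC ACE char_poly_conjmx //.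
  rewrite char_poly_trig ?diag_mx_is_trig // rmorph_prod; apply: eq_bigr => k _ /=.
  by rewrite map_polyXsubC mxE eqxx mulr1n spE mxE.
- by rewrite ReZ /Z -spE -ACE; apply/matrixP => i j; rewrite !mxE.
- move=> d; rewrite ReZ.
  have sum_normZ : \sum_i \sum_j `|Z d i j| ^+ 2 = toC (\sum_k d 0 k ^+ 2).
    (* The squared Frobenius norm is unitarily invariant, so it can be read off the diagonal
       form. *)
    transitivity (\tr (Z d *m (Z d)^t*)%sesqui).
      rewrite /mxtrace; apply: eq_bigr => i _; rewrite !mxE; apply: eq_bigr => j _.
      by rewrite !mxE normCK.
    rewrite /Z invmx_unitary // !trmx_mul !map_mxM trmxCK !mulmxA mulmxtVK //.
    rewrite mxtrace_mulC !mulmxA (unitarymxP P_unitary) mul1mx.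
    rewrite tr_diag_mx map_diag_mx mulmx_diag mxtrace_diag toC_sum.
    apply: eq_bigr => k _; rewrite !mxE.
    have -> : toC (d 0 k ^+ 2) = toC (d 0 k) * toC (d 0 k) by exact: (rmorphM toC).
    by congr (_ * _); apply: conj_Creal; rewrite complex_real.
  suff: toC (\sum_i \sum_j map_mx (@complex.Re R) (Z d) i j ^+ 2)
      <= toC (\sum_k d 0 k ^+ 2).
    by rewrite lecR.
  rewrite -sum_normZ toC_sum; apply: ler_sum => i _.
  rewrite toC_sum; apply: ler_sum => j _.
  by rewrite mxE -add_Re2_Im2 lecR lerDl sqr_ge0.
Qed.

(** The Gram matrix is the positive part of [s *: A]; subtracting [s] times it leaves only the
    eigenvalues [x] with [s * x < 0]. *)
Lemma gram_approximation (R : realType) n (A : 'M[R]_n) (s : R) :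
  A^T = A -> s ^+ 2 = 1 ->
  exists m (B : 'M[R]_(m, n)),
    \sum_i \sum_j (A - s *: (B^T *m B)) i j ^+ 2 <=
    \sum_(x \in [set x : R | eigenvalue A x /\ s * x < 0]%classic)
      (mup x (char_poly A))%:R * x ^+ 2.
Proof.
move=> symA s2; have [r [X [Y [charA AE M_le]]]] := symmetric_spectral symA.
set M := fun d : 'rV[R]_n => X^T *m diag_mx d *m X + Y^T *m diag_mx d *m Y.
pose d : 'rV[R]_n := \row_k Num.max 0 (s * r 0 k).
(* Square roots of the weights turn [M d] into a real Gram matrix; stacking the [X] and [Y] blocks
   adds their two contributions. *)
pose q : 'rV[R]_n := \row_k Num.sqrt (d 0 k).
exists (n + n)%N, (col_mx (diag_mx q *m X) (diag_mx q *m Y)).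
have qq : diag_mx q *m diag_mx q = diag_mx d.
  rewrite mulmx_diag; congr diag_mx; apply/rowP => k.
  by rewrite !mxE -expr2 sqr_sqrtr // le_max lexx.
have -> : (col_mx (diag_mx q *m X) (diag_mx q *m Y))^T *m
    col_mx (diag_mx q *m X) (diag_mx q *m Y) = M d.
  rewrite tr_col_mx mul_row_col !trmx_mul !tr_diag_mx !mulmxA.
  by rewrite -[X^T *m _ *m _]mulmxA -[Y^T *m _ *m _]mulmxA qq.
have -> : A - s *: M d = M (r - s *: d).
  have diagE : diag_mx (r - s *: d) = diag_mx r - s *: diag_mx d.
    by rewrite linearB linearZ.
  rewrite {1}AE /M diagE !(mulmxBr, mulmxBl) -!scalemxAr -!scalemxAl.
  by rewrite scalerDr opprD addrACA.
apply: le_trans (M_le _) _.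
have charA' : char_poly A = \prod_(y <- [seq r 0 k | k : 'I_n]) ('X - y%:P).
  by rewrite charA big_map big_enum.
rewrite (sum_eigenE [pred x | s * x < 0] (fun x => x ^+ 2) charA').
rewrite big_map big_enum_cond /= [leRHS]big_mkcond /=; apply: ler_sum => k _.
(* If [s * r 0 k] is nonnegative, the entry is [r 0 k - s * (s * r 0 k)], which is zero because
   [s ^+ 2 = 1]. *)
rewrite !mxE; have [sr_ge0|sr_lt0] := leP 0 (s * r 0 k); last by rewrite mulr0 subr0.
by rewrite mulrA -expr2 s2 mul1r subrr expr0n.
Qed.

Theorem theorem1 (R : realType) (V : finType) (e : rel V)
    (V_gt0 : (0 < #|V|)%N) (e_sym : symmetric e) (e_irr : irreflexive e) :
  2 * #|edge_set e|%:R / vec_chrom R e <=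
  Num.min (sum_sqr_pos_eigen (adj R e)) (sum_sqr_neg_eigen (adj R e)).
Proof.
have symA : (adj R e)^T = adj R e by apply/matrixP => i j; rewrite !mxE e_sym.
have chi_gt0 : 0 < vec_chrom R e := lt_le_trans ltr01 (vec_chrom_ge1 R e V_gt0).
rewrite ler_pdivrMr // [leRHS]mulrC -sum_adj //.
have main (s : R) : s ^+ 2 = 1 -> \sum_i \sum_j adj R e i j <= vec_chrom R e *
    \sum_(x \in [set x : R | eigenvalue (adj R e) x /\ s * x < 0]%classic)
      (mup x (char_poly (adj R e)))%:R * x ^+ 2.
  move=> s2; have [m [B B_le]] := gram_approximation symA s2.
  apply: le_trans (sum_adj_le B V_gt0 e_sym e_irr s2) _.
  by rewrite ler_wpM2l // ltW.
(* The sign [-1] selects the positive eigenvalues and the sign [1] the negative ones. *)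
rewrite /Num.min; case: ifP => _.
  have := main (-1); rewrite sqrrN expr1n => /(_ erefl).
  rewrite /sum_sqr_pos_eigen; congr (_ <= _ * _); apply: eq_fsbigl.
  by apply/seteqP; split => x /=; rewrite mulN1r oppr_lt0.
have := main 1; rewrite expr1n => /(_ erefl).
rewrite /sum_sqr_neg_eigen; congr (_ <= _ * _); apply: eq_fsbigl.
by apply/seteqP; split => x /=; rewrite mul1r.
Qed.
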